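(* Let $G$ be a connected graph with node set $\{0,1,\dots,n\}$. Suppose $G$ contains a cycle $C=C_{4m}$ of length $4m$ for an integer $m\ge1$. Let $V^+\cup V^-=\mathcal{V}(C)$ be the bipartition of the nodes of $C$ as a bipartite graph. If any path in $G$ connecting a node in $V^+$ and a node in $V^-$ includes at least one edge of $C$, then the algebraic Kuramoto system $$f_i(x_1,\dots,x_n)=-\sum_{j\sim i}\frac{1}{2\mathfrak{i}}\left(\frac{x_i}{x_j}-\frac{x_j}{x_i}\right),\qquad i=1,\dots,n,\quad x_0=1,$$ with uniform coupling coefficients $k_{ij}=1$ and zero natural frequencies has a positive-dimensional zero set in $(\mathbb{C}^* )^n$. Moreover, the corresponding transcendental Kuramoto system $$-\sum_{j\sim i}\sin(\theta_i-\theta_j)=0,\qquad i=1,\dots,n,\quad\theta_0=0,$$ has a positive-dimensional real zero set.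
   Context: $G$ is a finite simple connected undirected graph; $i\sim j$ means $\{i,j\}$ is an edge of $G$; $\mathfrak{i}$ is the imaginary unit; $\mathbb{C}^*=\mathbb{C}\setminus\{0\}$. $V^+$ and $V^-$ are the two colour classes of the even cycle $C$ (every edge of $C$ joins $V^+$ to $V^-$). *)

(* Defs.v *)
From HB Require Import structures.
From mathcomp Require Import all_boot all_order all_algebra.
(* [mpoly] is deliberately not imported: its notations clash with those of
   MathComp-Analysis. *)
From mathcomp Require mpoly.
From mathcomp.real_closed Require Export complex.
From mathcomp Require Import all_classical all_reals.
From mathcomp Require Import ereal topology normedtype derive trigo.

Set Implicit Arguments.
Unset Strict Implicit.
Unset Printing Implicit Defensive.

Import Order.TTheory GRing.Theory Num.Theory numFieldNormedType.Exports.
Local Open Scope classical_set_scope.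
Local Open Scope ring_scope.

Definition simple_graph (T : finType) (e : rel T) : Prop :=
  symmetric e /\ irreflexive e.

Definition connected_graph (T : finType) (e : rel T) : Prop :=
  forall u v : T, connect e u v.

(* A cycle is given by the duplicate-free cyclic sequence of its nodes (see
   [ucycle]); for a sequence of at least 3 nodes this is a cycle in the usual
   sense. [next c u] is the identity outside [c], hence the membership tests. *)
Definition cycle_edge (T : finType) (c : seq T) : rel T := fun u v =>
  [&& u \in c, v \in c & (next c u == v) || (next c v == u)].

Definition cycle_bipartition (T : finType) (c : seq T) (Vp Vm : {set T}) : Prop :=
  [/\ (forall u, (u \in c) = (u \in Vp) || (u \in Vm)),
      (forall u, ~~ ((u \in Vp) && (u \in Vm))) &
      (forall u v, cycle_edge c u v ->
         ((u \in Vp) && (v \in Vm)) || ((u \in Vm) && (v \in Vp)))].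

Definition path_uses_cycle_edge (T : finType) (c : seq T) (u : T) (p : seq T) : bool :=
  has (fun ab => cycle_edge c ab.1 ab.2) (zip (u :: p) p).

(* Node 0 is the reference node, with the fixed value [c]; the value at node
   [k + 1] is the [k]-th coordinate of [x]. *)
Definition pin0 (T : Type) (n : nat) (c : T) (x : 'rV[T]_n) (i : 'I_n.+1) : T :=
  if unlift ord0 i is Some k then x ord0 k else c.

Definition torus (K : fieldType) (n : nat) : set 'rV[K]_n :=
  [set x | forall k : 'I_n, x ord0 k != 0].

Definition alg_kuramoto (R : realType) (n : nat) (e : rel 'I_n.+1)
    (x : 'rV[R[i]]_n) (i : 'I_n.+1) : R[i] :=
  - \sum_(j < n.+1 | e i j)
      1 / (2%:R * 'i) * (pin0 1 x i / pin0 1 x j - pin0 1 x j / pin0 1 x i).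

Definition alg_kuramoto_zeros (R : realType) (n : nat) (e : rel 'I_n.+1) :
    set 'rV[R[i]]_n :=
  [set x | torus x /\
           forall i : 'I_n.+1, i != ord0 -> alg_kuramoto e x i = 0].

Definition kuramoto (R : realType) (n : nat) (e : rel 'I_n.+1)
    (theta : 'rV[R]_n) (i : 'I_n.+1) : R :=
  - \sum_(j < n.+1 | e i j) sin (pin0 0 theta i - pin0 0 theta j).

Definition kuramoto_zeros (R : realType) (n : nat) (e : rel 'I_n.+1) :
    set 'rV[R]_n :=
  [set theta | forall i : 'I_n.+1, i != ord0 -> kuramoto e theta i = 0].

Definition zero_locus (K : fieldType) (n : nat) (S : set (mpoly.mpoly n K)) :
    set 'rV[K]_n :=
  [set x | forall p, S p -> mpoly.meval (x ord0) p = 0].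

(* Closed subsets of [V] for the topology induced by the Zariski topology of
   affine space. For [V] in the torus, Laurent polynomials would give the same
   closed sets, since monomials are invertible there. *)
Definition zariski_closed_in (K : fieldType) (n : nat) (V Z : set 'rV[K]_n) : Prop :=
  exists S : set (mpoly.mpoly n K), Z = V `&` zero_locus S.

Definition zariski_irreducible (K : fieldType) (n : nat) (Z : set 'rV[K]_n) : Prop :=
  Z !=set0 /\
  forall A B : set 'rV[K]_n,
    zariski_closed_in Z A -> zariski_closed_in Z B ->
    Z = A `|` B -> Z = A \/ Z = B.

Definition zariski_chain (K : fieldType) (n : nat) (V : set 'rV[K]_n) (d : nat)
    (Z : nat -> set 'rV[K]_n) : Prop :=
  (forall k, (k <= d)%N -> zariski_closed_in V (Z k) /\ zariski_irreducible (Z k)) /\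
  (forall k, (k < d)%N -> Z k `<` Z k.+1).

(* Krull dimension of [V] with its Zariski topology; it is -oo when [V] is
   empty. [R] only serves to host the value. *)
Definition zariski_dim (R : realType) (K : fieldType) (n : nat)
    (V : set 'rV[K]_n) : \bar R :=
  ereal_sup [set (d%:R%:E : \bar R) | d in
              [set d : nat | exists Z, zariski_chain V d Z]].

(* C^oo: all iterated directional derivatives are (Frechet) differentiable. *)
Definition smooth_on (R : realType) (d n : nat) (U : set 'rV[R]_d)
    (phi : 'rV[R]_d -> 'rV[R]_n) : Prop :=
  forall (vs : seq 'rV[R]_d) (x : 'rV[R]_d), U x ->
    differentiable (foldr (fun v g => 'D_v g) phi vs) x.

(* [A] contains a [d]-dimensional submanifold, given by a local
   parametrization; an injective immersion is an embedding after shrinking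
   [U]. *)
Definition contains_submanifold (R : realType) (n : nat) (A : set 'rV[R]_n)
    (d : nat) : Prop :=
  exists (U : set 'rV[R]_d) (phi : 'rV[R]_d -> 'rV[R]_n),
    [/\ open U, U !=set0 & smooth_on U phi] /\
    [/\ (forall x y, U x -> U y -> phi x = phi y -> x = y),
        (forall x, U x -> injective ('d phi x : 'rV[R]_d -> 'rV[R]_n)) &
        (forall x, U x -> A (phi x))].

(* Dimension of a real analytic set, following Lojasiewicz: the supremum of
   the dimensions of the submanifolds it contains; -oo for the empty set. *)
Definition real_dim (R : realType) (n : nat) (A : set 'rV[R]_n) : \bar R :=
  ereal_sup [set (d%:R%:E : \bar R) | d in [set d : nat | contains_submanifold A d]].

(* Main.v *)
Require Import Defs.
From mathcomp Require Import all_boot all_order all_algebra.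
From mathcomp Require Import all_classical all_reals.
From mathcomp Require Import ereal topology normedtype derive trigo.
From mathcomp Require Import ring zify.
(* Only the algebraic structures of multivariate polynomials are imported: the
   notations of [mpoly] clash with those of analysis. *)
From mathcomp Require Import(canonicals) mpoly.

Set Implicit Arguments.
Unset Strict Implicit.
Unset Printing Implicit Defensive.

Import Order.TTheory GRing.Theory Num.Theory numFieldNormedType.Exports.
Local Open Scope classical_set_scope.
Local Open Scope ring_scope.

(** Remove the edges of the cycle [c] from the graph. By hypothesis no component
    of the remaining graph meets both [Vp] and [Vm]; let [b u] say whether [u]
    lies in a component meeting [Vm]. Then [b] is constant along the edges
    outside [c] and changes along the edges of [c]. Let [s u] be the parity of
    [k %/ 2], where [k] is the position of [u] on [c]: the signs (-1)^s read
    + + - - + + - - ... around [c], and since the length of [c] is a multiple of 4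
    the pattern closes up, so that the two neighbours on [c] of any node of [c]
    have opposite signs.

    Give the node [u] the phase pi * s(u) + b(u) * t for a free parameter [t]
    (after normalizing [b] and [s] to vanish at the reference node). Across an
    edge outside [c] the phase difference is a multiple of pi, so its coupling
    term vanishes; at a node of [c], the two terms of the cycle edges cancel,
    because the phases of the two neighbours differ by pi. The same computation,
    with z = exp(i t) replaced by an arbitrary nonzero complex number, applies to
    the algebraic system. Both cases are instances of [balanced_exists], where
    the coupling terms are arbitrary.

    Hence the real zero set contains an affine line (some [b u] is nonzero as [c]
    has edges), which is a submanifold of dimension 1. The zero set in the torus
    contains a line minus one point, which is Zariski closed in it, being cut out
    by linear equations, and irreducible, because a polynomial restricted to the
    line is a univariate polynomial, which has finitely many roots. A point of
    this punctured line followed by the line itself is a chain of length 1. *)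

(** * Sides and signs on the cycle *)

Section CycleSides.
Variables (T : finType) (e : rel T) (c : seq T).

(** The graph [e] without the edges of the cycle [c]. *)
Definition off_cycle : rel T := fun u v => e u v && ~~ cycle_edge c u v.

Lemma cycle_edge_sym : symmetric (cycle_edge c).
Proof. by move=> u v; rewrite /cycle_edge andbCA orbC. Qed.

Lemma off_cycle_path u p :
  path off_cycle u p -> path e u p /\ ~~ path_uses_cycle_edge c u p.
Proof.
elim: p u => [|v p IHp] u //= /andP[/andP[euv nuv] /IHp[ep np]].
by rewrite euv ep /path_uses_cycle_edge /= negb_or nuv.
Qed.

Variables Vp Vm : {set T}.

(** The component of [u] in the graph without the cycle edges meets [Vm]. *)
Definition minus_side (u : T) : bool := [exists v in Vm, connect off_cycle u v].

Lemma minus_side_off u v :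
  symmetric e -> off_cycle u v -> minus_side u = minus_side v.
Proof.
move=> eC ouv; have oC : symmetric off_cycle.
  by move=> x y; rewrite /off_cycle eC cycle_edge_sym.
have sub x y : off_cycle x y -> minus_side y -> minus_side x.
  move=> oxy /existsP[w /andP[wm yw]]; apply/existsP; exists w.
  by rewrite wm (connect_trans (connect1 oxy)).
by apply/idP/idP; apply: sub; rewrite // oC.
Qed.

Lemma minus_side_Vm u : u \in Vm -> minus_side u.
Proof. by move=> um; apply/existsP; exists u; rewrite um connect0. Qed.

Hypothesis separated : forall (u v : T) (p : seq T),
  u \in Vp -> v \in Vm -> path e u p -> uniq (u :: p) -> last u p = v ->
  path_uses_cycle_edge c u p.

(** The separation hypothesis concerns duplicate-free paths only, so a walk
    avoiding the cycle edges is first shortened. *)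
Lemma minus_side_Vp u : u \in Vp -> ~~ minus_side u.
Proof.
move=> up; apply/existsP => -[v /andP[vm /connectP[p0 op0 vE]]].
case/shortenP: op0 vE => p op Up _ vE.
have [ep /negP[]] := off_cycle_path op.
exact: separated up vm ep Up _.
Qed.

Lemma minus_side_cycle_edge u v : cycle_bipartition c Vp Vm ->
  cycle_edge c u v -> minus_side v = ~~ minus_side u.
Proof.
case=> _ _ bip /bip /orP[] /andP[ux vx].
  by rewrite (minus_side_Vm vx) (negbTE (minus_side_Vp ux)).
by rewrite (minus_side_Vm ux) (negbTE (minus_side_Vp vx)).
Qed.

End CycleSides.

Section CycleSigns.
Variables (T : finType) (c : seq T).
Hypothesis Uc : uniq c.

Lemma index_next u : u \in c ->
  index (next c u) c = ((index u c).+1 %% size c)%N.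
Proof.
rewrite next_nth => uc; rewrite uc; case: c Uc uc => [|y p] // Up uc.
have : (index u (y :: p) < (size p).+1)%N by rewrite index_mem.
rewrite ltnS leq_eqVlt => /orP[/eqP -> | lt].
  by rewrite nth_default // modnn /= eqxx.
rewrite modn_small //; set i := index u _ in lt *.
by rewrite -[nth y p i]/(nth y (y :: p) i.+1) index_uniq.
Qed.

(** Around the cycle this is the pattern 0 0 1 1 0 0 1 1 ... (a node outside [c]
    has index [size c], so the value there is a harmless constant). *)
Definition half_index_parity (u : T) : bool := odd (index u c)./2.

(** Across the end of the sequence this needs the length to be a multiple of 4:
    the index [k + 2] wraps around to [k + 2 - 4 * m]. *)
Lemma half_index_parity_next2 m u : size c = (4 * m)%N -> u \in c ->
  half_index_parity (next c (next c u)) = ~~ half_index_parity u.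
Proof.
move=> sz uc; rewrite /half_index_parity !index_next ?mem_next // sz.
have : (index u c < 4 * m)%N by rewrite -sz index_mem.
move: (index u c) => k; lia.
Qed.

End CycleSigns.

(** The pair [b], [s] is balanced when the sum over the neighbours of any node
    [i] of coupling terms [f j] vanishes as soon as terms on the side of [i] are
    zero, and terms on the same side with opposite signs are opposite. Both
    Kuramoto systems have coupling terms of this kind. *)
Definition balanced (T : finType) (e : rel T) (b s : T -> bool) : Prop :=
  forall (V : zmodType) (i : T) (f : T -> V),
    (forall j, b i = b j -> f j = 0) ->
    (forall j k, b j = b k -> s j = ~~ s k -> f j + f k = 0) ->
    \sum_(j | e i j) f j = 0.

(** The sides and signs of the cycle, translated so as to vanish at [x0]. *)
Lemma balanced_exists (T : finType) (e : rel T) (c : seq T) (Vp Vm : {set T})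
    (m : nat) (x0 : T) :
  symmetric e -> (1 <= m)%N -> ucycle e c -> size c = (4 * m)%N ->
  cycle_bipartition c Vp Vm ->
  (forall (u v : T) (p : seq T),
     u \in Vp -> v \in Vm -> path e u p -> uniq (u :: p) -> last u p = v ->
     path_uses_cycle_edge c u p) ->
  exists b s : T -> bool,
    [/\ b x0 = false, s x0 = false, exists k, b k & balanced e b s].
Proof.
move=> eC m_gt0 /andP[cyc Uc] sz bip sep.
pose b0 := minus_side e c Vm; pose s0 := half_index_parity c.
have b0E u v : cycle_edge c u v -> b0 v = ~~ b0 u.
  exact: (minus_side_cycle_edge sep bip).
have next_edge u : u \in c -> cycle_edge c u (next c u).
  by move=> uc; rewrite /cycle_edge uc mem_next uc eqxx.
exists (fun u => b0 u (+) b0 x0), (fun u => s0 u (+) s0 x0); split.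
- by rewrite addbb.
- by rewrite addbb.
- have [u uc] : exists u, u \in c.
    have c_gt0 : (0 < size c)%N by rewrite sz muln_gt0.
    by exists (nth x0 c 0); rewrite mem_nth.
  have E := b0E _ _ (next_edge u uc).
  case: (boolP (b0 u (+) b0 x0)) => h; first by exists u.
  by exists (next c u); rewrite E addNb.
move=> V i f f0 fC.
rewrite (bigID (cycle_edge c i)) /= [X in _ + X]big1 ?addr0; last first.
  move=> j oij; apply: f0; congr (_ (+) _).
  exact: minus_side_off.
have [ic | nic] := boolP (i \in c); last first.
  by apply: big_pred0 => j; rewrite /cycle_edge (negbTE nic) andbF.
have s2 : s0 (next c i) = ~~ s0 (prev c i).
  rewrite -{1}(next_prev Uc i); apply: (half_index_parity_next2 Uc sz).
  by rewrite mem_prev.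
have np : next c i != prev c i.
  by apply/eqP => E; move: s2; rewrite E; case: (s0 _).
rewrite (bigD1 (next c i)) /=; last by rewrite next_cycle // next_edge.
have ip : cycle_edge c i (prev c i).
  by rewrite /cycle_edge ic mem_prev ic next_prev ?eqxx ?orbT.
rewrite (bigD1 (prev c i)) /=; last by rewrite eC prev_cycle // ip eq_sym.
rewrite big_pred0 ?addr0 => [|j].
  apply: fC => /=; last by rewrite s2 addNb.
  by rewrite (b0E _ _ ip) (b0E _ _ (next_edge _ ic)).
apply/negP => /andP[/andP[/andP[_ /and3P[_ _ /orP[]/eqP]]]].
  by move=> ->; rewrite eqxx.
by move=> <-; rewrite prev_next ?eqxx.
Qed.

(** * Row vectors of nodal values *)

Section Pinned.
Variables (X : Type) (n : nat) (P : 'I_n.+1 -> X).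

(** The coordinates of a family of nodal values, dropping the reference node:
    a right inverse of [pin0]. *)
Definition unpin : 'rV[X]_n := \row_k P (lift ord0 k).

Lemma pin0_unpin i : pin0 (P ord0) unpin i = P i.
Proof. by rewrite /pin0; case: unliftP => [k ->|->] //; rewrite mxE. Qed.

End Pinned.

(** * Affine lines as real submanifolds *)

Section AffineLine.
Variables (R : realType) (n : nat).

Lemma derive_affine_line (a v : 'rV[R]_n) (w x : 'rV[R]_1) :
  'D_w (fun t : 'rV[R]_1 => a + t ord0 ord0 *: v) x = w ord0 ord0 *: v.
Proof.
apply: cvg_lim => //.
apply: cvg_near_cst; near=> h.
have h0 : h != 0 by near: h; exact: nbhs_dnbhs_neq.
rewrite /= !mxE opprD addrACA subrr add0r -scalerBl addrK.
by rewrite scalerA mulrA mulVf // mul1r.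
Unshelve. all: by end_near. Qed.

Lemma affine_line_submanifold (A : set 'rV[R]_n) (a v : 'rV[R]_n) :
  v != 0 -> (forall t : R, A (a + t *: v)) -> contains_submanifold A 1.
Proof.
move=> v0 Av; pose phi (t : 'rV[R]_1) := a + t ord0 ord0 *: v.
have scale_inj : injective (fun t : 'rV[R]_1 => t ord0 ord0 *: v).
  move=> x y /eqP; rewrite -subr_eq0 -scalerBl scaler_eq0 (negbTE v0) orbF.
  rewrite subr_eq0 => /eqP xy.
  by apply/rowP => i; rewrite ord1.
have dcoord x : differentiable (fun t : 'rV[R]_1 => t ord0 ord0) x.
  exact: differentiable_coord.
have diffphi x : differentiable phi x.
  by apply: differentiableD; [exact: differentiable_cst|exact: differentiableZl].
have dphi x w : 'd phi x w = w ord0 ord0 *: v.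
  by rewrite -deriveE // derive_affine_line.
exists setT, phi; split; split => //.
- exact: openT.
- by exists 0.
- move=> vs x _.
  (* Every iterated derivative of positive order is constant. *)
  suff [-> | [k ->]] : foldr (fun w g => 'D_w g) phi vs = phi \/
      exists k, foldr (fun w g => 'D_w g) phi vs = cst k.
  + exact: diffphi.
  + exact: differentiable_cst.
  elim: vs => [|w vs [|[k]] /= ->]; [by left | right | right].
    by exists (w ord0 ord0 *: v); apply/funext => y; rewrite derive_affine_line.
    by exists 0; apply/funext => y; rewrite derive_cst.
- by move=> x y _ _ /addrI /scale_inj.
- by move=> x _ y z; rewrite !dphi => /scale_inj.
- by move=> x _; exact: Av.
Qed.

End AffineLine.

(** * The line of real phases *)

Section RealLine.
Variables (R : realType) (n : nat) (e : rel 'I_n.+1) (b s : 'I_n.+1 -> bool).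
Hypothesis bal : balanced e b s.
Hypotheses (b0 : b ord0 = false) (s0 : s ord0 = false).

(** The phase at node [u]: 0 or pi according to its sign, shifted by the common
    parameter [t] on one of the two sides. *)
Definition phase (t : R) (u : 'I_n.+1) : R := pi * (s u)%:R + (b u)%:R * t.

Lemma phase0 t : phase t ord0 = 0.
Proof. by rewrite /phase b0 s0 mulr0 mul0r addr0. Qed.

Lemma kuramoto_phase t : kuramoto_zeros e (unpin (phase t)).
Proof.
move=> i _; have pinE := pin0_unpin (phase t); rewrite phase0 in pinE.
rewrite /kuramoto; apply/eqP; rewrite oppr_eq0; apply/eqP.
under eq_bigr do rewrite !pinE.
apply: bal => [j bE | j k bE sE].
  rewrite /phase bE opprD addrACA subrr addr0.
  by case: (s i) (s j) => -[];
    rewrite ?mulr1 ?mulr0 ?subrr ?sub0r ?subr0 ?sinN ?sin0 ?sinpi ?oppr0.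
(* The two neighbours have phases differing by pi. *)
have shift a : sin (a - pi) = - sin a :> R.
  by rewrite -[in RHS](subrK pi a) sinDpi opprK.
rewrite /phase bE sE; set a := _ + _ * t; set y := (b k)%:R * t.
case: (s k); rewrite /= ?mulr1 ?mulr0 ?add0r.
  by rewrite (addrC pi) opprD addrA shift addrN.
by rewrite (addrC pi) opprD addrA shift addNr.
Qed.

Lemma real_dim_gt0 k : b k -> (0 < real_dim (@kuramoto_zeros R n e))%E.
Proof.
move=> bk; apply: (@lt_le_trans _ _ (1%:R%:E)); first by rewrite lte_fin.
apply: ereal_sup_ubound; exists 1%N => //.
apply: (@affine_line_submanifold _ _ _ (unpin (phase 0))
          (unpin (fun u => (b u)%:R))).
  case: (unliftP ord0 k) bk => [j ->|->] bk; last by rewrite b0 in bk.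
  by apply/eqP => /rowP/(_ j)/eqP; rewrite !mxE bk oner_eq0.
move=> t; rewrite (_ : _ + _ = unpin (phase t)); first exact: kuramoto_phase.
by apply/rowP => j; rewrite !mxE /phase mulr0 addr0 (mulrC t).
Qed.
End RealLine.

(** * Punctured lines in the Zariski topology *)

Section ZariskiLine.
Variables (K : numFieldType) (n : nat).

(** The restriction of [p] to the line [a + z *: v], as a polynomial in [z]. *)
Definition along_line (a v : 'rV[K]_n) (p : mpoly.mpoly n K) : {poly K} :=
  mpoly.mmap (@polyC K) (fun k => (a ord0 k)%:P + (v ord0 k)%:P * 'X) p.

Lemma horner_along_line a v p z :
  (along_line a v p).[z] = mpoly.meval ((a + z *: v) ord0) p.
Proof.
rewrite mpoly.mevalE /along_line /mpoly.mmap horner_sum; apply: eq_bigr => w _.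
rewrite hornerM hornerC /mpoly.mmap1 horner_prod; congr (_ * _).
apply: eq_bigr => k _; rewrite horner_exp !hornerE !mxE; congr (_ ^+ _).
by rewrite (mulrC z).
Qed.

Lemma poly_vanish_units (q : {poly K}) :
  (forall z, z != 0 -> q.[z] = 0) -> q = 0.
Proof.
move=> q0; apply/eqP/negPn/negP => qn0.
have Urs : uniq [seq i.+1%:R : K | i <- iota 0 (size q)].
  by rewrite map_inj_uniq ?iota_uniq // => i j /eqP; rewrite eqr_nat => /eqP[].
suff rs : all (root q) [seq i.+1%:R : K | i <- iota 0 (size q)].
  by have := max_poly_roots qn0 rs Urs; rewrite size_map size_iota ltnn.
by apply/allP => _ /mapP[i _ ->]; apply/eqP; rewrite q0 // pnatr_eq0.
Qed.

(** The line through [a] in direction [v], without the point [a]. *)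
Definition punctured_line (a v : 'rV[K]_n) : set 'rV[K]_n :=
  [set a + z *: v | z in [set z : K | z != 0]].

Lemma punctured_line_irreducible a v : zariski_irreducible (punctured_line a v).
Proof.
split; first by exists (a + 1 *: v); exists 1 => //=; exact: oner_neq0.
move=> A B [S AE] [S' BE] LE.
set L := punctured_line a v in AE BE LE *.
have [SL | /existsNP[p /not_implyP[Sp pn0]]] :=
  pselect (forall p, S p -> along_line a v p = 0).
  left; rewrite AE; apply/seteqP; split=> [x Lx|x [] //]; split=> // p /SL p0.
  by case: Lx => z _ <-; rewrite -horner_along_line p0 horner0.
right; rewrite BE; apply/seteqP; split=> [x Lx|x [] //]; split=> // q S'q.
suff q0 : along_line a v q = 0.
  by case: Lx => z _ <-; rewrite -horner_along_line q0 horner0.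
have /eqP : along_line a v p * along_line a v q = 0.
  apply: poly_vanish_units => z z0; rewrite hornerM !horner_along_line.
  have : L (a + z *: v) by exists z.
  rewrite LE AE BE => -[[_ /(_ p Sp) ->]|[_ /(_ q S'q) ->]].
    by rewrite mul0r.
  by rewrite mulr0.
by rewrite mulf_eq0 => /orP[/eqP|/eqP].
Qed.

Lemma zariski_irreducible1 (x : 'rV[K]_n) : zariski_irreducible [set x].
Proof.
split; first by exists x.
move=> A B [S AE] [S' BE] xE.
have [Ax | Bx] : (A `|` B) x by rewrite -xE.
  by left; apply/seteqP; split=> [y ->//|y]; rewrite AE => -[].
by right; apply/seteqP; split=> [y ->//|y]; rewrite BE => -[].
Qed.

(** A subset of [V] is closed in [V] once the polynomials vanishing on it vanish
    at no other point of [V]. *)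
Lemma zariski_closed_in_vanishing (V Z : set 'rV[K]_n) :
  Z `<=` V ->
  (forall x, V x -> (forall p, (forall y, Z y -> mpoly.meval (y ord0) p = 0) ->
      mpoly.meval (x ord0) p = 0) -> Z x) ->
  zariski_closed_in V Z.
Proof.
move=> ZV ZP; exists [set p | forall y, Z y -> mpoly.meval (y ord0) p = 0].
apply/seteqP; split=> [x Zx|x [Vx zx]]; last exact: ZP.
by split; [exact: ZV | move=> p; apply].
Qed.

(** The polynomial X_k - g X_l - h. *)
Definition linear_mpoly (k l : 'I_n) (g h : K) : mpoly.mpoly n K :=
  mpoly.mpolyX K (mpoly.mnm1 k)
  - mpoly.mpolyC n g * mpoly.mpolyX K (mpoly.mnm1 l) - mpoly.mpolyC n h.

Lemma meval_linear_mpoly k l g h (x : 'rV[K]_n) :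
  mpoly.meval (x ord0) (linear_mpoly k l g h) = x ord0 k - g * x ord0 l - h.
Proof.
rewrite /linear_mpoly !mpoly.mevalB mpoly.mevalM !mpoly.mevalC.
by rewrite !mpoly.mevalXU.
Qed.

Lemma zariski_closed_in1 (V : set 'rV[K]_n) x :
  V x -> zariski_closed_in V [set x].
Proof.
move=> Vx; apply: zariski_closed_in_vanishing => [y -> //|y Vy yP].
apply/rowP => k; have := yP (linear_mpoly k k 0 (x ord0 k)).
rewrite meval_linear_mpoly mul0r subr0 => /(_ _)/eqP; rewrite subr_eq0 => H.
by apply/eqP/H => z ->; rewrite meval_linear_mpoly mul0r subr0 subrr.
Qed.

(** When [v] has a nonzero coordinate [k], the line is given by expressing every
    coordinate as an affine function of the coordinate [k]; the last hypothesis
    says that [V] does not contain the removed point. *)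
Lemma punctured_line_closed (V : set 'rV[K]_n) (a v : 'rV[K]_n) k :
  v ord0 k != 0 -> punctured_line a v `<=` V ->
  (forall z, V (a + z *: v) -> z != 0) ->
  zariski_closed_in V (punctured_line a v).
Proof.
move=> vk LV V0; apply: zariski_closed_in_vanishing => // x Vx xP.
pose z := (x ord0 k - a ord0 k) / v ord0 k.
suff xE : x = a + z *: v by exists z => //=; apply: V0; rewrite -xE.
apply/rowP => l; pose g := v ord0 l / v ord0 k.
have := xP (linear_mpoly l k g (a ord0 l - g * a ord0 k)).
rewrite meval_linear_mpoly => H; rewrite !mxE.
have {H} /eqP : x ord0 l - g * x ord0 k - (a ord0 l - g * a ord0 k) = 0.
  apply: H => _ [t _ <-]; rewrite meval_linear_mpoly !mxE.
  have <- : g * v ord0 k = v ord0 l by rewrite divfK.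
  ring.
rewrite subr_eq0 subr_eq => /eqP ->; rewrite /z /g; ring.
Qed.

Lemma zariski_dim_line_gt0 (R : realType) (V : set 'rV[K]_n)
    (a v : 'rV[K]_n) :
  v != 0 -> punctured_line a v `<=` V -> (forall z, V (a + z *: v) -> z != 0) ->
  (0 < zariski_dim R V)%E.
Proof.
move=> v0 LV V0; have [k vk] : exists k, v ord0 k != 0.
  apply/not_existsP => H; case/eqP: v0; apply/rowP => k; rewrite mxE.
  exact/eqP/negPn/negP/H.
have L1 : punctured_line a v (a + v).
  by exists 1; rewrite /= ?oner_neq0 // scale1r.
apply: (@lt_le_trans _ _ (1%:R%:E)); first by rewrite lte_fin.
apply: ereal_sup_ubound; exists 1%N => //.
(* The chain is the point of parameter 1, then the whole punctured line. *)
exists (fun j => if j is 0%N then [set a + v] else punctured_line a v); split.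
  case=> [|j] _; split.
  - exact/zariski_closed_in1/LV.
  - exact: zariski_irreducible1.
  - exact: punctured_line_closed vk LV V0.
  - exact: punctured_line_irreducible.
case=> // _; split; first by move=> x ->.
(* The point of parameter 2 lies on the line and differs from [a + v]. *)
move=> /(_ (a + 2%:R *: v)) H.
have /H/addrI/eqP : punctured_line a v (a + 2%:R *: v).
  by exists 2%:R; rewrite //= pnatr_eq0.
rewrite -subr_eq0 -[X in _ - X]scale1r -scalerBl scaler_eq0 (negbTE v0) orbF.
by rewrite -(natrB _ (leqnSn 1)) oner_eq0.
Qed.

End ZariskiLine.

(** * The punctured line of complex phases *)

Section ComplexLine.
Variables (R : realType) (n : nat) (e : rel 'I_n.+1) (b s : 'I_n.+1 -> bool).
Hypothesis bal : balanced e b s.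
Hypotheses (b0 : b ord0 = false) (s0 : s ord0 = false).

(** The value at node [u]: its sign, multiplied by the common parameter [z] on
    one of the two sides. For nonzero [z] it solves the algebraic system. *)
Definition unit_phase (z : R[i]) (u : 'I_n.+1) : R[i] :=
  (-1) ^+ s u * (if b u then z else 1).

Lemma unit_phase0 z : unit_phase z ord0 = 1.
Proof. by rewrite /unit_phase b0 s0 mulr1. Qed.

Lemma unit_phase_neq0 z u : z != 0 -> unit_phase z u != 0.
Proof.
by move=> z0; rewrite mulf_neq0 ?signr_eq0 //; case: (b u); rewrite ?oner_neq0.
Qed.

Lemma alg_kuramoto_unit_phase z : z != 0 ->
  alg_kuramoto_zeros e (unpin (unit_phase z)).
Proof.
move=> z0; split=> [k|i _]; first by rewrite mxE unit_phase_neq0.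
have pinE := pin0_unpin (unit_phase z); rewrite unit_phase0 in pinE.
rewrite /alg_kuramoto; apply/eqP; rewrite oppr_eq0; apply/eqP.
under eq_bigr do rewrite !pinE.
apply: bal => [j bE | j k bE sE].
  have w0 : (if b j then z else 1) != 0 by case: (b j); rewrite ?oner_neq0.
  rewrite /unit_phase bE -!mulf_div divff // !mulr1.
  by case: (s i) (s j) => -[];
    rewrite /= ?expr0 ?expr1 ?invr1 ?invrN1 ?mulr1 ?mul1r subrr mulr0.
have -> : unit_phase z j = - unit_phase z k.
  by rewrite /unit_phase bE sE signrN mulNr.
by rewrite invrN mulrN mulNr; ring.
Qed.

Lemma zariski_dim_gt0 k :
  b k -> (0 < zariski_dim R (@alg_kuramoto_zeros R n e))%E.
Proof.
move=> bk; pose a : 'rV[R[i]]_n := unpin (unit_phase 0).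
pose v : 'rV[R[i]]_n := unpin (fun u => (-1) ^+ s u * (b u)%:R).
have lineE z : a + z *: v = unpin (unit_phase z).
  apply/rowP => j; rewrite !mxE /unit_phase; case: (b _).
    by rewrite mulr0 add0r mulr1 mulrC.
  by rewrite !mulr0 addr0.
case: (unliftP ord0 k) bk => [j ->|->] bj; last by rewrite b0 in bj.
apply: (@zariski_dim_line_gt0 _ _ R _ a v).
- by apply/eqP => /rowP/(_ j)/eqP; rewrite !mxE bj mulr1 signr_eq0.
- by move=> _ [z z0 <-]; rewrite lineE; exact: alg_kuramoto_unit_phase.
move=> z; rewrite lineE => -[/(_ j)]; rewrite mxE /unit_phase bj.
by rewrite mulf_eq0 negb_or => /andP[].
Qed.
End ComplexLine.

(** * Positive-dimensional zero sets *)

Theorem proposition5p7 (R : realType) (n m : nat) (e : rel 'I_n.+1)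
    (c : seq 'I_n.+1) (Vp Vm : {set 'I_n.+1}) :
  simple_graph e -> connected_graph e ->
  (1 <= m)%N -> ucycle e c -> size c = (4 * m)%N ->
  cycle_bipartition c Vp Vm ->
  (forall (u v : 'I_n.+1) (p : seq 'I_n.+1),
     u \in Vp -> v \in Vm ->
     path e u p -> uniq (u :: p) -> last u p = v ->
     path_uses_cycle_edge c u p) ->
  (0 < zariski_dim R (@alg_kuramoto_zeros R n e))%E /\
  (0 < real_dim (@kuramoto_zeros R n e))%E.
Proof.
move=> [eC _] _ m_gt0 cyc sz bip sep.
have [b [s [b0 s0 [k bk] bal]]] :=
  balanced_exists ord0 eC m_gt0 cyc sz bip sep.
split; first exact: zariski_dim_gt0 bal b0 s0 _ bk.
exact: real_dim_gt0 bal b0 s0 _ bk.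
Qed.
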